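(* Let $n\geq 3$ and let $G$ be a finite simple graph of order $n$ with diameter $2$ such that $n'(G)>\frac{n-1}{2}$. Then $E_2(G)>W(G)$.
   Context: A vertex of $G$ is universal if its degree is $n(G)-1$; $n'(G)$ denotes the number of universal vertices. $\varepsilon_G(v)=\max_u d_G(v,u)$ is the eccentricity, $E_2(G)=\sum_{uv\in E(G)}\varepsilon_G(u)\varepsilon_G(v)$, and $W(G)=\sum_{\{u,v\}\subseteq V(G)}d_G(u,v)$ is the Wiener index. *)

(* Defs.v *)
From mathcomp Require Import all_boot all_order all_algebra.

Set Implicit Arguments.
Unset Strict Implicit.
Unset Printing Implicit Defensive.

(* A finite simple graph is a symmetric and irreflexive relation on a finType. *)
Definition simple_graph (T : finType) (e : rel T) : Prop :=
  symmetric e /\ irreflexive e.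

Definition walk_of_length (T : finType) (e : rel T) (u v : T) (k : nat) : bool :=
  [exists p : k.-tuple T, path e u p && (last u p == v)].

(* [find] returns the least k < #|T| such that a walk of length k joins u to v.
   Connected vertices are at distance less than #|T|, so the default value #|T|
   stands for the infinite distance of vertices in different components.  In
   particular a graph of order at least 3 and diameter 2 is connected. *)
Definition gdist (T : finType) (e : rel T) (u v : T) : nat :=
  find (walk_of_length e u v) (iota 0 #|T|).

Definition ecc (T : finType) (e : rel T) (v : T) : nat := \max_(u : T) gdist e v u.

Definition diam (T : finType) (e : rel T) : nat := \max_(v : T) ecc e v.

Definition deg (T : finType) (e : rel T) (v : T) : nat := #|[set u | e v u]|.

Definition universal (T : finType) (e : rel T) (v : T) : bool :=
  deg e v == #|T|.-1.

Definition num_universal (T : finType) (e : rel T) : nat :=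
  #|[set v | universal e v]|.

(* Each unordered pair {u, v} with u != v is represented once, by the ordered
   pair that is increasing for the canonical enumeration of T. *)
Definition increasing_pair (T : finType) (p : T * T) : bool :=
  enum_rank p.1 < enum_rank p.2.

Definition E2 (T : finType) (e : rel T) : nat :=
  \sum_(p : T * T | increasing_pair p && e p.1 p.2) ecc e p.1 * ecc e p.2.

Definition Wiener (T : finType) (e : rel T) : nat :=
  \sum_(p : T * T | increasing_pair p) gdist e p.1 p.2.

(* Main.v *)
(** Distinct vertices u, v satisfy d(u,v) <= 2, and d(u,v) = 1 as soon as one of
    them is universal; moreover a non-universal vertex has eccentricity at
    least 2.  So a pair of universal vertices contributes at least as much to E2
    as to W, a mixed pair at least one more, and a pair of non-universal vertices
    at most 2 less.  With k universal and m non-universal vertices this gives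
    E2 - W >= k m - m (m - 1), which is positive since k >= m > 0. *)
Require Import Defs.
From mathcomp Require Import all_boot all_order all_algebra.
From mathcomp Require Import zify.

Set Implicit Arguments.
Unset Strict Implicit.
Unset Printing Implicit Defensive.

Section Distance.

Variables (T : finType) (e : rel T).
Implicit Types u v : T.

Lemma walk_of_length0 u v : walk_of_length e u v 0 = (u == v).
Proof.
apply/existsP/eqP => [[p]|->]; first by rewrite tuple0 => /eqP.
by exists [tuple]; rewrite /= eqxx.
Qed.

Lemma walk_of_length1 u v : walk_of_length e u v 1 = e u v.
Proof.
apply/existsP/idP => [[p]|euv]; last by exists [tuple v]; rewrite /= euv eqxx.
by case/tupleP: p => x p; rewrite tuple0 /= andbT => /andP[eux /eqP <-].
Qed.

Lemma card_gt1_neq u v : u != v -> 1 < #|T|.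
Proof. by move=> neq_uv; have := max_card (pred2 u v); rewrite card2 neq_uv. Qed.

Lemma gdist_gt0 u v : u != v -> 0 < gdist e u v.
Proof.
move=> neq_uv; have := card_gt1_neq neq_uv; rewrite /gdist.
by case: #|T| => // n _ /=; rewrite walk_of_length0 (negPf neq_uv).
Qed.

(** Two distinct vertices force [#|T|] to be at least 2, so [find] really tests the lengths 0 and 1.
    Both tests fail, and any later result, the default [#|T|] included, is at least 2. *)
Lemma gdist_gt1 u v : u != v -> ~~ e u v -> 1 < gdist e u v.
Proof.
move=> neq_uv /negPf neuv; have := card_gt1_neq neq_uv; rewrite /gdist.
case: #|T| => [|[|n]] // _ /=.
by rewrite walk_of_length0 walk_of_length1 (negPf neq_uv) neuv.
Qed.

Lemma gdist_refl u : gdist e u u = 0.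
Proof.
have : 0 < #|T| by apply/card_gt0P; exists u.
by rewrite /gdist; case: #|T| => // n _ /=; rewrite walk_of_length0 eqxx.
Qed.

Lemma gdist_adj u v : irreflexive e -> e u v -> gdist e u v <= 1.
Proof.
move=> irr euv.
have neq_uv : u != v by apply: contraTneq euv => ->; rewrite irr.
have := card_gt1_neq neq_uv; rewrite /gdist; case: #|T| => [|[|n]] // _ /=.
by rewrite walk_of_length0 walk_of_length1 (negPf neq_uv) euv.
Qed.

Lemma gdist_le_ecc u v : gdist e u v <= ecc e u.
Proof. exact: (leq_bigmax v). Qed.

Lemma ecc_le_diam u : ecc e u <= diam e.
Proof. exact: (leq_bigmax u). Qed.

(** By irreflexivity the neighbourhood of [u] lies in the complement of [u], which has [#|T|.-1]
    elements; hence equal cardinality means equal sets. *)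
Lemma universalP u :
  irreflexive e -> reflect (forall v, u != v -> e u v) (universal e u).
Proof.
move=> irr; have sub : [set v | e u v] \subset [set~ u].
  apply/subsetP => v; rewrite !inE; apply: contraTneq => ->.
  by rewrite irr.
have [_ eq_card] := subset_leqif_cards sub.
rewrite /universal /deg -(cardsC1 u) eq_card.
apply: (iffP eqP) => [/setP eq_nbr v neq_uv|adj].
  by have := eq_nbr v; rewrite !inE eq_sym neq_uv.
by apply/setP => v; rewrite !inE eq_sym; apply/idP/idP => [|/adj //];
  apply: contraTneq => ->; rewrite irr.
Qed.

Lemma ecc_gt0 u : 1 < #|T| -> 0 < ecc e u.
Proof.
move=> T_gt1; have : 0 < #|[set~ u]| by rewrite cardsC1; lia.
case/card_gt0P => v; rewrite !inE eq_sym => neq_uv.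
exact: leq_trans (gdist_gt0 neq_uv) (gdist_le_ecc u v).
Qed.

Lemma ecc_gt1 u : irreflexive e -> ~~ universal e u -> 1 < ecc e u.
Proof.
move=> irr nu; rewrite ltnNge; apply: contra nu => ecc_le1.
apply/(universalP _ irr) => v neq_uv; apply: contraLR ecc_le1 => neuv.
by rewrite -ltnNge (leq_trans (gdist_gt1 neq_uv neuv)) ?gdist_le_ecc.
Qed.

Lemma diam_le1 : irreflexive e -> (forall u, universal e u) -> diam e <= 1.
Proof.
move=> irr univ; apply/bigmax_leqP => u _; apply/bigmax_leqP => v _.
have [->|neq_uv] := eqVneq u v; first by rewrite gdist_refl.
exact/gdist_adj/(universalP _ irr).
Qed.

End Distance.

(** Swapping coordinates matches increasing pairs with decreasing ones. This reduces counting
    unordered pairs to counting the partners of each vertex. *)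
Lemma sum_increasing_pair (T : finType) (f : T -> T -> nat) :
  (forall u v, f u v = f v u) ->
  2 * (\sum_(p : T * T | increasing_pair p) f p.1 p.2) =
  \sum_u \sum_(v | v != u) f u v.
Proof.
move=> f_sym; rewrite pair_big_dep /=.
rewrite [RHS](bigID (@increasing_pair T)) /= mul2n -addnn; congr (_ + _).
  apply: eq_bigl => -[u v]; rewrite /increasing_pair /=.
  by case: eqVneq => // ->; rewrite ltnn.
rewrite (reindex_inj (h := fun p : T * T => (p.2, p.1))) /=; last first.
  by move=> [u v] [u' v'] [-> ->].
apply: eq_big => [[u v]|[u v] _]; rewrite /increasing_pair /= 1?f_sym //.
(* Distinct vertices have distinct ranks, so a pair of them that is not increasing is strictly
   decreasing. *)
rewrite -leqNgt ltn_neqAle; congr (_ && _).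
by rewrite (inj_eq val_inj) (inj_eq enum_rank_inj).
Qed.

Section PairCounts.

Variables (T : finType) (A : pred T).

Lemma sum_mixed_pairs :
  \sum_(p : T * T | increasing_pair p) (A p.1 (+) A p.2) =
  #|[set u | A u]| * #|[set u | ~~ A u]|.
Proof.
set k := #|_|; set m := #|_ : {set T}|.
have cA : \sum_u (A u : nat) = k by rewrite /k -sum1dep_card [RHS]big_mkcond.
have cnA : \sum_u (~~ A u : nat) = m by rewrite /m -sum1dep_card [RHS]big_mkcond.
apply/eqP; rewrite -(eqn_pmul2l (isT : 0 < 2)); apply/eqP.
rewrite (sum_increasing_pair (f := fun u v => A u (+) A v)); last first.
  by move=> u v; rewrite addbC.
(* A vertex in [A] has [m] partners outside and a vertex outside has [k] partners inside, which
   gives [2 * k * m] ordered mixed pairs. *)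
transitivity (\sum_u (A u * m + ~~ A u * k)); last first.
  by rewrite big_split /= -!big_distrl /= cA cnA; lia.
apply: eq_bigr => u _; rewrite -cA -cnA.
rewrite [in RHS](bigD1 u) //= [X in _ + _ * X](bigD1 u) //=.
by case: (A u) => /=; rewrite !(mul0n, mul1n, add0n, addn0).
Qed.

Lemma sum_inner_pairs :
  2 * (\sum_(p : T * T | increasing_pair p) (A p.1 && A p.2)) =
  #|[set u | A u]| * #|[set u | A u]|.-1.
Proof.
set k := #|_|.
have cA : \sum_u (A u : nat) = k by rewrite /k -sum1dep_card [RHS]big_mkcond.
rewrite (sum_increasing_pair (f := fun u v => A u && A v)); last first.
  by move=> u v; rewrite andbC.
transitivity (\sum_u (A u * k.-1)); last by rewrite -big_distrl /= cA.
(* Splitting the term of [u] off the count [k] accounts for the predecessor: [u] is not its own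
   partner. *)
apply: eq_bigr => u _; rewrite -cA [in RHS](bigD1 u) //=.
by case: (A u) => /=; rewrite ?mul1n ?mul0n ?add1n // big1.
Qed.

End PairCounts.

(** Moving the losses to the right avoids truncated subtraction. Both products become sums over
    increasing pairs, and the inequality then holds pair by pair. *)
Lemma Wiener_le_E2 (T : finType) (e : rel T) :
  simple_graph e -> diam e = 2 -> 1 < #|T| ->
  Wiener e + num_universal e * #|[set u | ~~ universal e u]| <=
  E2 e + #|[set u | ~~ universal e u]| * #|[set u | ~~ universal e u]|.-1.
Proof.
move=> [sym irr] diam2 T_gt1.
rewrite /Wiener /num_universal -sum_mixed_pairs -sum_inner_pairs /E2.
(* Non-adjacent pairs enter [E2] with value 0, so that all four sums share one index set. *)
rewrite big_mkcondr big_distrr /= -!big_split /=.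
apply: leq_sum => -[u v]; rewrite /increasing_pair /= => lt_uv.
have neq_uv : u != v by apply: contraTneq lt_uv => ->; rewrite ltnn.
have d2 : gdist e u v <= 2.
  by rewrite -diam2 (leq_trans (gdist_le_ecc e u v)) ?ecc_le_diam.
have d1 := @gdist_adj T e u v irr.
have eu1 := ecc_gt0 e u T_gt1; have ev1 := ecc_gt0 e v T_gt1.
have eu2 := @ecc_gt1 T e u irr; have ev2 := @ecc_gt1 T e v irr.
have adj_u : universal e u -> e u v by move/(universalP _ irr); apply.
have adj_v : universal e v -> e u v.
  by rewrite sym eq_sym in neq_uv *; move/(universalP _ irr); apply.
case: (universal e u) adj_u eu2 => [/(_ isT) euv _|_ /(_ isT) eu2];
  case: (universal e v) adj_v ev2 => [/(_ isT) evu _|_ /(_ isT) ev2] /=.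
- by rewrite evu; have := d1 evu; nia.
- by rewrite euv; have := d1 euv; nia.
- by rewrite evu; have := d1 evu; nia.
- lia.
Qed.

Theorem theorem2p7 (n : nat) (T : finType) (e : rel T) :
  3 <= n ->
  simple_graph e ->
  #|T| = n ->
  diam e = 2 ->
  ((n%:R - 1) / 2%:R < (num_universal e)%:R :> rat)%R ->
  E2 e > Wiener e.
Proof.
move=> n_ge3 simple cardT diam2 many_univ.
have n_le : n <= num_universal e * 2.
  move: many_univ; rewrite Num.Theory.ltr_pdivrMr ?Num.Theory.ltr0n //.
  by rewrite Num.Theory.ltrBlDr -GRing.natrM GRing.natr1 Num.Theory.ltr_nat ltnS.
have T_gt1 : 1 < #|T| by lia.
have := Wiener_le_E2 simple diam2 T_gt1.
set m := #|_ : {set T}|.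
have card_split : num_universal e + m = n.
  rewrite -cardT -(cardsC [set u | universal e u]) /num_universal; congr (_ + _).
  by apply: eq_card => u; rewrite !inE.
(* If every vertex were universal, the diameter would be at most 1. *)
have m_gt0 : 0 < m.
  rewrite lt0n; apply/negP => /eqP/cards0_eq/setP m0.
  have : diam e <= 1.
    apply: diam_le1; first by case: simple.
    by move=> u; have := m0 u; rewrite !inE => /negbFE.
  by rewrite diam2.
(* With k universal vertices, k + m = n <= 2 k gives m <= k, hence k m >= m m > m (m - 1). *)
nia.
Qed.
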